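(* Let $n\ge 1$ and let $\mathscr{H}$ be a discrete-time continuous-state Hopfield network (with state space $X$, weight matrix $\mathbf{W}=(w_{ij})_{1\le i,j\le n}$, external bias vector $\mathbf{b}=(b_1,\ldots,b_n)$ and activation functions $f_1,\ldots,f_n$) satisfying the following conditions: (H1) The state space is $X=[0,1]^n$ and $b_i=0$ for each $i$. (H2) The weight matrix $\mathbf{W}=(w_{ij})$ has positive entries and $\frac34<\sum_{j=1}^n w_{ij}<1$ for every $i$. (H3) The activation functions $f_i:[0,\infty)\to[0,\infty)$ are defined by $$ f_i(x)=\begin{cases} \dfrac{1}{2\rho}x+\delta v_i & \text{if } x\in\left[0,\,2(1-\delta)\rho v_i\right),\\[0.1in] \dfrac{1}{2\rho}x+(\delta-1)v_i & \text{if } x\in\left[2(1-\delta)\rho v_i,\,\rho v_i\right],\\[0.1in] \dfrac12 v_i+(\delta-1)v_i & \text{if } x\in[\rho v_i,\infty),\end{cases}\qquad\text{where}\quad \delta=\frac12+\frac14\sum_{k\ge 0}\frac{\omega_k}{2^k},$$ $\boldsymbol{\omega}=\omega_0\omega_1\omega_2\ldots$ is the Fibonacci word, $\rho$ is the Perron-Frobenius eigenvalue of $\mathbf{W}$, and $\mathbf{v}=(v_1,\ldots,v_n)$ is the associated probability eigenvector. Then $\mathscr{H}$ is a chaotic Hopfield network.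
   Context: **Hopfield network.** A discrete-time continuous-state Hopfield network consists of a compact state space $X\subset[0,\infty)^n$ with non-empty interior and a piecewise-smooth map $\mathbf{F}=(F_1,\ldots,F_n):[0,\infty)^n\to[0,\infty)^n$ such that $\mathbf{F}(X)\subset X$ and $$F_i(x_1,\ldots,x_n)=f_i\Big(\sum_{j=1}^n w_{ij}x_j-b_i\Big)\quad(1\le i\le n),$$ where $\mathbf{W}=(w_{ij})$ is a square matrix of size $n$ (the weight matrix), $\mathbf{b}=(b_1,\ldots,b_n)$ is a vector (the external bias vector), and $f_1,\ldots,f_n$ are piecewise-smooth functions (the activation functions). **Orbits.** Given an initial state $\mathbf{x}^{(0)}\in X$, its network orbit is the sequence $(\mathbf{x}^{(k)})_{k\ge 0}$ defined recursively by $\mathbf{x}^{(k)}=\mathbf{F}(\mathbf{x}^{(k-1)})$ for $k\ge1$. The $\omega$-limit set of this orbit is $$\omega(\mathbf{x}^{(0)})=\{\mathbf{p}\in\mathbb{R}^n:\ \exists\, n_1<n_2<n_3<\cdots \text{ such that } \lim_{k\to\infty}\mathbf{x}^{(n_k)}=\mathbf{p}\}.$$ **Sensitive dependence.** With $\Vert\cdot\Vert$ the Euclidean norm on $\mathbb{R}^n$, the network orbits have sensitive dependence on initial conditions at $\mathbf{x}^{(0)}\in X$ if for some constant $\eta>0$ the following holds: for each $\epsilon>0$ there exist $\mathbf{y}^{(0)}\in X$ and $k\in\mathbb{N}$ such that $\Vert\mathbf{y}^{(0)}-\mathbf{x}^{(0)}\Vert\le\epsilon$ and $\Vert\mathbf{y}^{(k)}-\mathbf{x}^{(k)}\Vert\ge\eta$,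 where $(\mathbf{y}^{(k)})_{k\ge0}$ and $(\mathbf{x}^{(k)})_{k\ge0}$ are the network orbits with initial states $\mathbf{y}^{(0)}$ and $\mathbf{x}^{(0)}$, respectively. **Chaotic Hopfield network.** A discrete-time continuous-state Hopfield network with state space $X$ is chaotic if there exists a Cantor set $C\subset X$ such that: (C1) $\omega(\mathbf{x}^{(0)})=C$ for each $\mathbf{x}^{(0)}\in C$; (C2) the network orbits have sensitive dependence on initial conditions at all $\mathbf{x}^{(0)}\in C$. **Fibonacci word.** The Fibonacci word $\boldsymbol{\omega}=\omega_0\omega_1\omega_2\ldots=0100101001001\ldots$ is the binary sequence defined by $\omega_i=2+\lfloor(i+1)\varphi\rfloor-\lfloor(i+2)\varphi\rfloor$ for $i\ge0$, where $\varphi=(1+\sqrt5)/2$ and $\lfloor x\rfloor$ denotes the integral part of $x$. **Perron-Frobenius data.** For a square matrix $\mathbf{W}$ with positive entries, the Perron-Frobenius eigenvalue $\rho$ is its spectral radius, and the associated probability eigenvector is the unique vector $\mathbf{v}=(v_1,\ldots,v_n)$ with positive entries, $\sum_{i=1}^n v_i=1$ and $\mathbf{W}\mathbf{v}=\rho\mathbf{v}$. *)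

(* Defs.v *)
From HB Require Import structures.
From mathcomp Require Import all_boot all_order all_algebra.
From mathcomp Require Import all_classical all_reals all_analysis.
From mathcomp Require Import complex.

Set Implicit Arguments.
Unset Strict Implicit.
Unset Printing Implicit Defensive.

Import Order.TTheory GRing.Theory Num.Theory.
Import numFieldNormedType.Exports.

Local Open Scope classical_set_scope.
Local Open Scope ring_scope.

(* In finite dimension, f is C^k on the open set U iff all its iterated
   directional derivatives of order <= k exist and are continuous on U. *)
Fixpoint Ck_on (R : realType) (V W : normedModType R) (k : nat)
    (U : set V) (f : V -> W) : Prop :=
  (forall x, U x -> {for x, continuous f}) /\
  match k with
  | 0 => True
  | k'.+1 => forall v : V,
      (forall x, U x -> derivable f x v) /\ Ck_on k' U ('D_v f)
  end.

Definition smooth_on (R : realType) (V W : normedModType R)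
    (U : set V) (f : V -> W) : Prop :=
  forall k, Ck_on k U f.

(* D is cut into finitely many disjoint connected open pieces, on each of which
   f is the restriction of a map that is smooth up to the boundary of the piece.
   Discontinuities, and arbitrary values, are allowed on the boundaries of the
   pieces, which cover the rest of D. *)
Definition piecewise_smooth (R : realType) (V W : normedModType R)
    (D : set V) (f : V -> W) : Prop :=
  exists (p : nat) (U : 'I_p -> set V),
    [/\ forall k, [/\ open (U k), connected (U k) & U k `<=` D],
        trivIset setT U,
        D `<=` closure (\bigcup_k U k) &
        forall k, exists (O : set V) (g : V -> W),
          [/\ open O, closure (U k) `<=` O, smooth_on O g &
              forall x, U k x -> f x = g x]].

Definition orthant (R : realType) (n : nat) : set 'cV[R]_n :=
  [set x | forall i, 0 <= x i 0].
Arguments orthant : clear implicits.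

(* The activation functions are total in Rocq; their values outside of act_dom
   are irrelevant. *)
Record hopfield_network (R : realType) (n : nat) := HopfieldNetwork {
  state_space : set 'cV[R]_n ;
  weight : 'M[R]_n ;
  bias : 'cV[R]_n ;
  act_dom : 'I_n -> set R ;
  act : 'I_n -> R -> R ;
  network_map (x : 'cV[R]_n) : 'cV[R]_n :=
    \col_i act i (\sum_j weight i j * x j 0 - bias i 0) ;
  state_space_orthant : state_space `<=` orthant R n ;
  state_space_compact : compact state_space ;
  state_space_interior : state_space° !=set0 ;
  act_piecewise_smooth : forall i, piecewise_smooth (act_dom i) (act i) ;
  act_dom_arg : forall i x, orthant R n x ->
    act_dom i (\sum_j weight i j * x j 0 - bias i 0) ;
  network_map_piecewise_smooth : piecewise_smooth (orthant R n) network_map ;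
  network_map_orthant : set_fun (orthant R n) (orthant R n) network_map ;
  network_map_state_space : set_fun state_space state_space network_map }.

Definition network_orbit (R : realType) (n : nat) (H : hopfield_network R n)
    (x0 : 'cV[R]_n) (k : nat) : 'cV[R]_n :=
  iter k (network_map H) x0.

Definition omega_limit (R : realType) (n : nat) (H : hopfield_network R n)
    (x0 : 'cV[R]_n) : set 'cV[R]_n :=
  [set p | exists m : nat -> nat, {homo m : i j / (i < j)%N} /\
     network_orbit H x0 (m k) @[k --> \oo] --> p].

(* The library norm on matrices is the sup norm. *)
Definition euclidean_norm (R : realType) (n : nat) (x : 'cV[R]_n) : R :=
  Num.sqrt (\sum_i x i 0 ^+ 2).

Definition sensitive_dependence_at (R : realType) (n : nat)
    (H : hopfield_network R n) (x0 : 'cV[R]_n) : Prop :=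
  exists2 eta : R, 0 < eta & forall eps : R, 0 < eps ->
    exists (y0 : 'cV[R]_n) (k : nat),
      [/\ state_space H y0, euclidean_norm (y0 - x0) <= eps &
          eta <= euclidean_norm (network_orbit H y0 k - network_orbit H x0 k)].

Definition cantor_set (T : topologicalType) (C : set T) : Prop :=
  [/\ C !=set0, compact C, perfect_set C & totally_disconnected C].

Definition chaotic (R : realType) (n : nat) (H : hopfield_network R n) : Prop :=
  exists C : set 'cV[R]_n,
    [/\ cantor_set C,
        C `<=` state_space H,
        forall x0, C x0 -> omega_limit H x0 = C &
        forall x0, C x0 -> sensitive_dependence_at H x0].

Definition golden_ratio (R : realType) : R := (1 + Num.sqrt 5) / 2.

Definition fibonacci_word (R : realType) (i : nat) : int :=
  2 + Num.floor (i.+1%:R * golden_ratio R) - Num.floor (i.+2%:R * golden_ratio R).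

Definition fibonacci_delta (R : realType) : R :=
  2^-1 + 4^-1 * limn (series (fun k => (fibonacci_word R k)%:~R / 2 ^+ k : R)).

Definition spectral_radius (R : realType) (n : nat) (W : 'M[R]_n) : R :=
  sup [set ComplexField.Normc.normc z |
        z in [set z : R[i] | eigenvalue (map_mx (real_complex R) W) z]].

Definition perron_frobenius_data (R : realType) (n : nat) (W : 'M[R]_n)
    (rho : R) (v : 'cV[R]_n) : Prop :=
  [/\ rho = spectral_radius W, forall i, 0 < v i 0,
      \sum_i v i 0 = 1 & W *m v = rho *: v].

(* Main.v *)
Require Import Defs.
From HB Require Import structures.
From mathcomp Require Import all_boot all_order all_algebra.
From mathcomp Require Import all_classical all_reals all_analysis.
From mathcomp Require Import ring lra zify.

Set Implicit Arguments.
Unset Strict Implicit.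
Unset Printing Implicit Defensive.

Import Order.TTheory GRing.Theory Num.Theory.
Import numFieldNormedType.Exports.

Local Open Scope classical_set_scope.
Local Open Scope ring_scope.

(** On the ray spanned by the Perron-Frobenius eigenvector [v] the network is
    one-dimensional: the kinks of the activation functions are scaled by [v] so
    that [F (t v) = g (t) v], where [g] is the contracted rotation
    [t |-> t / 2 + delta mod 1] of the unit interval, whose only discontinuity is
    [c = 2 (1 - delta)]. The Cantor set is [K v], with [K] the attractor of [g],
    so that everything is a statement about [g].

    The bias [delta] is the value for which [g] has rotation number
    [alpha = 2 - phi] ([angle]), which is irrational. This is made concrete by inverting
    the semiconjugacy. Seek an increasing [Phi] with [Phi (t + 1) = Phi t + 1]
    that carries the translation by [alpha] to the lift
    [x |-> (x + floor x) / 2 + delta] of [g]. If [floor (Phi t) = floor t], then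

      [Phi (t + alpha) = (Phi t + floor t) / 2 + delta],

    and iterating backwards forces
    [Phi t = 2 delta + sum_(j >= 1) 2^-j floor (t - j alpha)]. This [Phi]
    ([staircase true]) is strictly increasing and right-continuous, and it jumps
    exactly at the points [j alpha] modulo 1 with [j >= 1]; replacing [floor x]
    by [ceil x - 1] gives its left-continuous version ([staircase false]).
    The hypothesis on [floor] made above holds as soon as [Phi 0 = 0], and
    summation by parts turns that into the definition of [delta] from the
    Fibonacci word, whose letters are the increments of [ceil (k alpha)]
    ([fibonacci_deltaE], [staircase0]).

    Let [K] consist of the values of both versions on the unit circle. Then:
    - [g] maps [K] into itself and acts there as the rotation by [alpha]
      ([contracted_rotation_staircase]). At the discontinuity the two versions
      agree, because [- alpha] is not in the forward orbit of 0, so the value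
      chosen by [g] at [c] does no harm;
    - [K] is compact, perfect and nowhere dense, since [Phi] is strictly
      increasing, is one-sidedly continuous and jumps on a dense set
      ([attractor_closed], [attractor_limit_point], [attractor_gap]);
    - every orbit in [K] is dense in [K], because the rotation is minimal and
      [Phi] has one-sided limits ([attractor_orbit_dense]);
    - two nearby points of [K] have circle coordinates at a fixed distance [d];
      minimality drives the arc between them across the point 0, and then one
      orbit is near 1 and the other near 0 ([attractor_sensitive]). *)

(** * Dyadic means of bounded sequences *)

Section DyadicMean.
Variable R : realType.
Implicit Types (u w : nat -> R) (B : R).

(** The weights [1/2, 1/4, ...] have total mass 1, so constants are their own
    mean, and no normalization appears in the recursion [dyadic_meanS]. *)
Definition dyadic_mean u : R := limn (series (fun k => u k / 2 ^+ k.+1)).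

Lemma cvg_geometric_half B :
  series (fun k => B / 2 ^+ k.+1) x @[x --> \oo] --> B.
Proof.
have h2 : `|2^-1 : R| < 1 by rewrite ger0_norm; lra.
have := cvg_geometric_series (a := B / 2) h2.
have -> : B / 2 / (1 - 2^-1) = B by field.
suff -> : geometric (B / 2) 2^-1 = (fun k => B / 2 ^+ k.+1) by [].
apply/funext => k /=; rewrite exprS exprVn invfM; ring.
Qed.

Lemma dyadic_mean_cvg u B : (forall k, `|u k| <= B) ->
  cvgn (series (fun k => u k / 2 ^+ k.+1)).
Proof.
move=> uB; apply: normed_cvg; rewrite /normed_series_of.
apply: (@series_le_cvg _ _ (fun k => B / 2 ^+ k.+1)) => [k|k|k|] //=.
- by rewrite divr_ge0 ?exprn_ge0// (le_trans _ (uB 0%N)).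
- rewrite normrM [X in _ * X]ger0_norm ?invr_ge0 ?exprn_ge0//.
  by rewrite ler_wpM2r ?invr_ge0 ?exprn_ge0.
- by apply/cvg_ex; exists B; exact: cvg_geometric_half.
Qed.

Lemma dyadic_mean_cst B : dyadic_mean (fun=> B) = B.
Proof. by apply: cvg_lim => //; exact: cvg_geometric_half. Qed.

Lemma dyadic_mean_le u w B : (forall k, `|u k| <= B) -> (forall k, `|w k| <= B) ->
  (forall k, u k <= w k) -> dyadic_mean u <= dyadic_mean w.
Proof.
move=> uB wB uw; apply: lim_series_le.
- exact: dyadic_mean_cvg uB.
- exact: dyadic_mean_cvg wB.
by move=> k; rewrite ler_wpM2r ?invr_ge0 ?exprn_ge0.
Qed.

Lemma dyadic_meanD u w B : (forall k, `|u k| <= B) -> (forall k, `|w k| <= B) ->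
  dyadic_mean (fun k => u k + w k) = dyadic_mean u + dyadic_mean w.
Proof.
move=> /dyadic_mean_cvg uB /dyadic_mean_cvg wB.
rewrite /dyadic_mean -lim_seriesD//; congr (limn (series _)).
by apply/funext => k /=; rewrite -[RHS]/(_ + _) -mulrDl.
Qed.

Lemma dyadic_meanN u B : (forall k, `|u k| <= B) ->
  dyadic_mean (fun k => - u k) = - dyadic_mean u.
Proof.
move=> /dyadic_mean_cvg uB.
rewrite /dyadic_mean -lim_seriesN//; congr (limn (series _)).
by apply/funext => k /=; rewrite -[RHS]/(- _) mulNr.
Qed.

Lemma dyadic_meanS u B : (forall k, `|u k| <= B) ->
  dyadic_mean u = (u 0%N + dyadic_mean (fun k => u k.+1)) / 2.
Proof.
move=> uB; apply: cvg_lim => //; rewrite -cvg_shiftS /=.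
have h : (fun n => series (fun k => u k / 2 ^+ k.+1) n.+1) =
    (fun n => (u 0%N + series (fun k => u k.+1 / 2 ^+ k.+1) n) / 2).
  apply/funext => n; rewrite /series /= big_nat_recl// mulrDl expr1.
  rewrite mulr_suml; congr (_ + _); apply: eq_bigr => k _.
  by rewrite [in LHS]exprS invfM; ring.
rewrite h; apply: cvgM; last exact: cvg_cst.
apply: cvgD; first exact: cvg_cst.
by apply: (@dyadic_mean_cvg _ B) => k; exact: uB.
Qed.

End DyadicMean.

(** * The rotation angle *)

Section Angle.
Variable R : realType.

(** The rotation number [2 - phi = 1 / phi ^ 2] of the contracted rotation. *)
Definition angle : R := 2 - golden_ratio R.

Lemma golden_ratio_sqr : golden_ratio R ^+ 2 = golden_ratio R + 1.
Proof.
rewrite /golden_ratio; have : Num.sqrt 5 ^+ 2 = 5 :> R by rewrite sqr_sqrtr.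
by move: (Num.sqrt 5) => s; rewrite !expr2 => hs; field: hs.
Qed.

Lemma angle_gt0 : 0 < angle.
Proof.
have g2 := golden_ratio_sqr.
have : 0 <= golden_ratio R by rewrite /golden_ratio divr_ge0// addr_ge0// sqrtr_ge0.
rewrite /angle; nra.
Qed.

Lemma angle_lt1 : angle < 1.
Proof.
have g2 := golden_ratio_sqr.
have : 0 <= golden_ratio R by rewrite /golden_ratio divr_ge0// addr_ge0// sqrtr_ge0.
rewrite /angle; nra.
Qed.

Lemma angle_sqr : angle ^+ 2 = 3 * angle - 1.
Proof.
have := golden_ratio_sqr; rewrite /angle; move: (golden_ratio R) => g; nra.
Qed.

(** Because [alpha ^ 2 = 3 alpha - 1], the powers of [alpha] are integer
    combinations of [alpha] and 1. The inequality keeps the coefficient of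
    [alpha] nonnegative along the recursion: it must count forward iterations. *)
Lemma angle_power m : exists (q : nat) (p : int),
  angle ^+ m.+1 = q%:R * angle - p%:~R /\ p <= 2 * q%:Z.
Proof.
elim: m => [|m [q [p [E pq]]]]; first by exists 1%N, 0; split => //; ring.
have : 0 <= 3 * q%:Z - p by lia.
case E' : (3 * q%:Z - p) => [k|//] _.
exists k, q%:Z; split; last by lia.
have -> : (k%:R : R) = (Posz k)%:~R by [].
rewrite -E' exprS E mulrBr mulrCA -expr2 angle_sqr.
rewrite rmorphB rmorphM /=; ring.
Qed.

Lemma expn_small (x c eps : R) : 0 <= x < 1 -> 0 < eps -> exists m, c * x ^+ m < eps.
Proof.
move=> /andP[x0 x1] e0.
have : geometric c x @ \oo --> (0 : R) by apply: cvg_geometric; rewrite ger0_norm.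
move=> /cvgr0Pnorm_lt /(_ _ e0) [m _ /(_ m (leqnn m))] /= h.
by exists m; apply: le_lt_trans h; exact: ler_norm.
Qed.

(** The powers of [alpha] tend to 0, so a suitable forward iterate of the
    rotation is an arbitrarily short positive translation of the circle. This
    replaces the pigeonhole principle, and gives irrationality and minimality. *)
Lemma angle_small_multiple (eps : R) : 0 < eps ->
  exists (q : nat) (p : int), 0 < q%:R * angle - p%:~R < eps.
Proof.
move=> e0; have := angle_gt0; have := angle_lt1 => a1 a0.
have [|m hm] := @expn_small angle angle eps _ e0; first by rewrite ltW.
have [q [p [E _]]] := angle_power m.
by exists q, p; rewrite -E exprn_gt0//= exprS.
Qed.

(** If [(k + 1) alpha] were an integer, then no positive [q alpha - p] could be
    smaller than [1 / (k + 1)]. *)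
Lemma angle_irrational k (z : int) : k.+1%:R * angle != z%:~R.
Proof.
apply/eqP => kz.
have k0 : 0 < k.+1%:R :> R by rewrite ltr0n.
have [|q [p /andP[h0 h1]]] := @angle_small_multiple k.+1%:R^-1; first by rewrite invr_gt0.
have E : k.+1%:R * (q%:R * angle - p%:~R) = (q%:Z * z - k.+1%:Z * p)%:~R :> R.
  rewrite mulrBr mulrCA kz rmorphB !rmorphM /=; congr (_ - _).
have : 0 < k.+1%:R * (q%:R * angle - p%:~R) by rewrite mulr_gt0.
have : k.+1%:R * (q%:R * angle - p%:~R) < 1 by rewrite -ltr_pdivlMl// mulr1.
by rewrite E (ltrz1 R) ltr0z; lia.
Qed.

(** Start at time [N] and repeat a positive translation shorter than the target
    interval: it cannot step over it. *)
Lemma angle_dense (y a b : R) N : a < b ->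
  exists k (z : int), (N <= k)%N /\ a < y + k%:R * angle - z%:~R < b.
Proof.
move=> ab; have [|q [p /andP[h0 h1]]] := @angle_small_multiple (b - a); first by rewrite subr_gt0.
set e := _ - _ in h0 h1.
pose y' := y + N%:R * angle.
pose z := Num.floor (y' - a) + 1.
have hz : y' - a < z%:~R by exact: floorD1_gt.
have hx : 0 <= (z%:~R + a - y') / e by rewrite divr_ge0//; lra.
pose m := (Num.trunc ((z%:~R + a - y') / e)).+1.
have /andP[t0 t1] : m.-1%:R <= (z%:~R + a - y') / e < m%:R by exact: truncn_itv.
have mE : m%:R = m.-1%:R + 1 :> R by rewrite natr1.
exists (N + m * q)%N, (z + m%:Z * p); split; first exact: leq_addr.
have -> : y + (N + m * q)%:R * angle - (z + m%:Z * p)%:~R = y' + m%:R * e - z%:~R.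
  rewrite /e /y' natrD natrM rmorphD rmorphM /=; ring.
move: t0 t1; rewrite ler_pdivlMr// ltr_pdivrMr// mE; nra.
Qed.

End Angle.

(** * The staircase *)

Section Staircase.
Variable R : realType.
Implicit Types (b : bool) (x y s t : R).
Local Notation angle := (angle R).
Local Notation delta := (fibonacci_delta R).

(** The right-continuous and the left-continuous integral part; the boolean says
    from which side the values are approached. *)
Definition side_floor b x : int := if b then Num.floor x else Num.ceil x - 1.

Lemma side_floor_itv b x : (side_floor b x)%:~R <= x <= (side_floor b x)%:~R + 1.
Proof.
rewrite /side_floor; case: b.
  by have := floor_itv x; rewrite rmorphD /= => /andP[-> /ltW].
by have := ceil_itv x; rewrite rmorphB /= subrK => /andP[/ltW -> ->].
Qed.

Lemma side_floorDz b x (z : int) : side_floor b (x + z%:~R) = side_floor b x + z.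
Proof.
rewrite /side_floor; case: b; first by rewrite floorDrz ?intrKfloor ?intr_int.
by rewrite ceilDrz ?intrKceil ?intr_int// addrAC.
Qed.

Lemma le_side_floor b x y : x <= y -> side_floor b x <= side_floor b y.
Proof.
move=> xy; rewrite /side_floor; case: b; first exact: le_floor.
by rewrite lerD2r; exact: le_ceil.
Qed.

Lemma side_floor_false_true x : side_floor false x <= side_floor true x.
Proof.
rewrite /side_floor floor_ge_int; have /andP[+ _] := ceil_itv x; exact: ltW.
Qed.

Lemma side_floor_true_false x y : x < y -> side_floor true x <= side_floor false y.
Proof.
move=> xy; rewrite /side_floor lerBrDr lezD1 ceil_gt_int.
exact: le_lt_trans (floor_le _) xy.
Qed.

Lemma side_floor_nonint b x : (forall z : int, x != z%:~R) ->
  side_floor b x = Num.floor x.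
Proof.
move=> xz; case: b => //; rewrite /side_floor ceil_floor.
case: (boolP (x \is a Num.int)) => [/intrP[z xE]|_]; last by rewrite addrK.
by have := xz z; rewrite xE eqxx.
Qed.

Definition side_nbhd b d x y : bool :=
  if b then x <= y < x + d else x - d < y <= x.

Lemma side_floor_locally_constant b x :
  exists2 d, 0 < d & forall y, side_nbhd b d x y -> side_floor b y = side_floor b x.
Proof.
rewrite /side_nbhd /side_floor; case: b.
  have /andP[h0 h1] := floor_itv x.
  exists ((Num.floor x + 1)%:~R - x); first by rewrite subr_gt0.
  move=> y /andP[xy yd]; apply: floor_def; apply/andP; split; first exact: le_trans xy.
  lra.
have /andP[h0 h1] := ceil_itv x.
exists (x - (Num.ceil x - 1)%:~R); first by rewrite subr_gt0.
move=> y /andP[yd xy]; congr (_ - 1); apply: ceil_def; apply/andP; split; last exact: le_trans h1.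
lra.
Qed.

Lemma side_nbhd_le b d d' x y : d <= d' -> side_nbhd b d x y -> side_nbhd b d' x y.
Proof. by rewrite /side_nbhd; case: b => dd /andP[? ?]; apply/andP; lra. Qed.

Lemma side_nbhdB b d x y s : side_nbhd b d (x - s) (y - s) = side_nbhd b d x y.
Proof. by rewrite /side_nbhd; case: b; apply/idP/idP => /andP[? ?]; apply/andP; lra. Qed.

Definition side_frac b x : R := x - (side_floor b x)%:~R.

Lemma side_frac_itv b x : 0 <= side_frac b x <= 1.
Proof. by rewrite /side_frac; have := side_floor_itv b x; lra. Qed.

Lemma side_frac_norm b x : `|side_frac b x| <= 1.
Proof. by rewrite ler_norml; have := side_frac_itv b x; lra. Qed.

Definition staircase_defect b t : R :=
  dyadic_mean (fun j => side_frac b (t - j.+1%:R * angle)).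

(** As the dyadic mean of [(j + 1) alpha] is [2 alpha], this is
    [2 delta + sum_(j >= 1) 2^-j side_floor b (t - j alpha)]; taking fractional
    parts makes the sequence that is averaged bounded. *)
Definition staircase b t : R := t + 2 * (delta - angle) - staircase_defect b t.

Lemma staircase_defect_itv b t : 0 <= staircase_defect b t <= 1.
Proof.
have n0 (k : nat) : `|0 : R| <= 1 by rewrite normr0.
have n1 (k : nat) : `|1 : R| <= 1 by rewrite normr1.
apply/andP; split.
  rewrite -[X in X <= _](dyadic_mean_cst (0 : R)).
  apply: (@dyadic_mean_le _ _ _ 1) => // k; first exact: side_frac_norm.
  by have /andP[] := side_frac_itv b (t - k.+1%:R * angle).
rewrite -[X in _ <= X](dyadic_mean_cst (1 : R)).
apply: (@dyadic_mean_le _ _ _ 1) => // k; first exact: side_frac_norm.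
by have /andP[] := side_frac_itv b (t - k.+1%:R * angle).
Qed.

(** The semiconjugacy equation. Monotonicity and the jumps come from this
    equation and from the boundedness of [staircase b t - t]; no series is
    estimated for them. *)
Lemma staircaseD b t :
  staircase b (t + angle) = (staircase b t + (side_floor b t)%:~R) / 2 + delta.
Proof.
rewrite /staircase; suff -> : staircase_defect b (t + angle) =
    (side_frac b t + staircase_defect b t) / 2 by rewrite /side_frac; field.
rewrite /staircase_defect (@dyadic_meanS _ _ 1) => [|k]; last exact: side_frac_norm.
rewrite mul1r addrK; congr ((_ + dyadic_mean _) / 2); apply/funext => j.
congr (side_frac b _); rewrite -[j.+2%:R]natr1; ring.
Qed.

Lemma staircaseB b t :
  staircase b t =
  (staircase b (t - angle) + (side_floor b (t - angle))%:~R) / 2 + delta.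
Proof. by rewrite -staircaseD subrK. Qed.

Lemma staircaseDz b t (z : int) : staircase b (t + z%:~R) = staircase b t + z%:~R.
Proof.
rewrite /staircase; suff -> : staircase_defect b (t + z%:~R) = staircase_defect b t.
  by ring.
congr dyadic_mean; apply/funext => j.
rewrite /side_frac [t + _ - _]addrAC side_floorDz rmorphD /=; ring.
Qed.

Lemma staircase_itv b t : staircase b t - 1 - 2 * (delta - angle) <= t <=
  staircase b t + 1 - 2 * (delta - angle).
Proof. rewrite /staircase; have := staircase_defect_itv b t; lra. Qed.

(** By the functional equation a defect in monotonicity is at most half of the
    defect one step back in time, and all defects are bounded; hence there is
    none. *)
Lemma staircase_le_of_side_floor b b' s t : s <= t ->
  (forall j, side_floor b (s - j.+1%:R * angle) <= side_floor b' (t - j.+1%:R * angle)) ->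
  staircase b s <= staircase b' t.
Proof.
move=> st hfl; apply/ler_addgt0Pr => e e0.
have [|m hm] := @expn_small R 2^-1 2 e _ e0; first by lra.
(* All defects are at most 2 because [staircase_defect] lies in [0, 1]. *)
suff : forall m s t, s <= t ->
  (forall j, side_floor b (s - j.+1%:R * angle) <= side_floor b' (t - j.+1%:R * angle)) ->
  staircase b s <= staircase b' t + 2 * 2^-1 ^+ m.
  by move=> /(_ m s t st hfl); lra.
move=> {}m {e e0 hm st hfl s t}; elim: m => [|m IH] s t st hfl.
  by have := staircase_defect_itv b s; have := staircase_defect_itv b' t;
    rewrite /staircase expr0; lra.
rewrite (staircaseB b) (staircaseB b') exprS.
have : staircase b (s - angle) <= staircase b' (t - angle) + 2 * 2^-1 ^+ m.
  apply: IH => [|j]; first by rewrite lerD2r.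
  have := hfl j.+1; rewrite -[j.+2%:R]natr1 mulrDl mul1r [_ + angle]addrC.
  by rewrite !opprD !addrA.
have : (side_floor b (s - angle))%:~R <= (side_floor b' (t - angle))%:~R :> R.
  by rewrite ler_int; have := hfl 0%N; rewrite mul1r.
lra.
Qed.

Lemma le_staircase b s t : s <= t -> staircase b s <= staircase b t.
Proof.
move=> st; apply: staircase_le_of_side_floor => // j.
by apply: le_side_floor; rewrite lerD2r.
Qed.

Lemma staircase_false_true t : staircase false t <= staircase true t.
Proof. by apply: staircase_le_of_side_floor => // j; exact: side_floor_false_true. Qed.

Lemma staircase_true_false s t : s < t -> staircase true s <= staircase false t.
Proof.
move=> st; apply: staircase_le_of_side_floor => [|j]; first exact: ltW.
by apply: side_floor_true_false; rewrite ltrD2r.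
Qed.

(** Equal values propagate backwards in time, so the integral parts of
    [s - j alpha] and [t - j alpha] would agree for all [j >= 1]; but some
    [j alpha] falls between [s] and [t] modulo 1. *)
Lemma lt_staircase_true s t : s < t -> staircase true s < staircase true t.
Proof.
move=> st; rewrite lt_neqAle (le_staircase true (ltW st)) andbT; apply/eqP => E.
have same j : staircase true (s - j%:R * angle) = staircase true (t - j%:R * angle) /\
    Num.floor (s - j.+1%:R * angle) = Num.floor (t - j.+1%:R * angle).
  have step u w : u <= w -> staircase true u = staircase true w ->
      staircase true (u - angle) = staircase true (w - angle) /\
      Num.floor (u - angle) = Num.floor (w - angle).
    move=> uw; rewrite (staircaseB _ u) (staircaseB _ w).
    have uw' : u - angle <= w - angle by rewrite lerD2r.
    have := le_staircase true uw'; have := le_side_floor true uw'.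
    rewrite /= -(ler_int R) => h1 h2 h3.
    by split; [lra|apply/eqP; rewrite -(eqr_int R); apply/eqP; lra].
  have jS u i : u - i.+1%:R * angle = u - i%:R * angle - angle.
    by rewrite -[i.+1%:R]natr1; ring.
  elim: j => [|j [IH _]].
    by rewrite mul0r !subr0 mul1r; split=> //; exact: (step _ _ (ltW st) E).2.
  have le0 i : s - i%:R * angle <= t - i%:R * angle by rewrite lerD2r ltW.
  have [h _] := step _ _ (le0 j) IH.
  rewrite (jS s j.+1) (jS t j.+1) !(jS _ j); split => //.
  by have := step (s - j.+1%:R * angle) _ (le0 _); rewrite !jS => /(_ h) [].
have [k [z [k1 /andP[h0 h1]]]] := angle_dense 0 1 st.
case: k k1 h0 h1 => // k _ h0 h1.
have [_ fE] := same k.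
have : Num.floor (s - k.+1%:R * angle) < - z by rewrite floor_lt_int rmorphN /=; lra.
have : - z <= Num.floor (t - k.+1%:R * angle) by rewrite floor_ge_int rmorphN /=; lra.
by rewrite fE => /le_lt_trans h /h; rewrite ltxx.
Qed.

Lemma lt_staircase b b' s t : s < t -> staircase b s < staircase b' t.
Proof.
move=> st; apply: (@le_lt_trans _ _ (staircase true s)).
  by case: b => //; exact: staircase_false_true.
apply: (@lt_le_trans _ _ (staircase true ((s + t) / 2))).
  by apply: lt_staircase_true; lra.
apply: (@le_trans _ _ (staircase false t)); first by apply: staircase_true_false; lra.
by case: b' => //; exact: staircase_false_true.
Qed.

(** The oscillation on an interval of length at most 1 is at most 1, and one step
    back in time halves it as long as the integral part is constant there. *)
Lemma staircase_side_continuous b t e : 0 < e ->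
  exists2 d, 0 < d & forall s, side_nbhd b d t s -> `|staircase b s - staircase b t| <= e.
Proof.
move=> e0; have [|m hm] := @expn_small R 2^-1 1 e _ e0; first by lra.
suff {e e0 hm} [d d0 hd] : exists2 d, 0 < d & forall s, side_nbhd b d t s ->
    `|staircase b s - staircase b t| <= 2^-1 ^+ m.
  by exists d => // s /hd /le_trans; apply; rewrite ltW// -[X in X < _]mul1r.
elim: m t => [|m IH] t.
  exists 1 => // s; rewrite expr0 ler_norml /side_nbhd.
  have hN1 : staircase b (t - 1) = staircase b t - 1 by exact: (staircaseDz b t (- 1)).
  have hP1 : staircase b (t + 1) = staircase b t + 1 by exact: (staircaseDz b t 1).
  case: b hN1 hP1 => hN1 hP1 /andP[h1 h2].
    by have := le_staircase true h1; have := le_staircase true (ltW h2); lra.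
  by have := le_staircase false h2; have := le_staircase false (ltW h1); lra.
have [d1 d10 h1] := IH (t - angle).
have [d2 d20 h2] := side_floor_locally_constant b (t - angle).
exists (Num.min d1 d2); first by rewrite lt_min d10.
move=> s; rewrite -(side_nbhdB _ _ _ _ angle) => hs.
have /h1 {}h1 : side_nbhd b d1 (t - angle) (s - angle).
  by apply: side_nbhd_le hs; rewrite ge_min lexx.
have /h2 {}h2 : side_nbhd b d2 (t - angle) (s - angle).
  by apply: side_nbhd_le hs; rewrite ge_min lexx orbT.
move: h1; rewrite (staircaseB b s) (staircaseB b t) h2 exprS !ler_norml; lra.
Qed.

(** The values of both versions converge, since strict monotonicity squeezes the
    wrong-sided version between values of the right-sided one. *)
Lemma staircase_side_limit b t e : 0 < e ->
  exists2 d, 0 < d & forall s b', side_nbhd b d t s -> s != t ->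
    `|staircase b' s - staircase b t| <= e.
Proof.
move=> /(staircase_side_continuous b t) [d d0 hd]; exists d => // s b' /[dup] hs + st.
rewrite /side_nbhd; case: b hd hs => hd hs /andP[h1 h2].
  have {}h1 : t < s by rewrite lt_def st.
  have /hd : side_nbhd true d t ((s + (t + d)) / 2) by apply/andP; lra.
  have /(lt_staircase b' true) : s < (s + (t + d)) / 2 by lra.
  by have := lt_staircase true b' h1; rewrite !ler_norml; lra.
have {}h2 : s < t by rewrite lt_neqAle st.
have /hd : side_nbhd false d t ((s + (t - d)) / 2) by apply/andP; lra.
have /(lt_staircase false b') : (s + (t - d)) / 2 < s by lra.
by have := lt_staircase b' false h2; rewrite !ler_norml; lra.
Qed.

(** The integral part jumps by 1 at every integer; the functional equation
    carries this jump along the orbit of 0, halved at every step. *)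
Lemma staircase_jump k (z : int) :
  staircase false (k.+1%:R * angle - z%:~R) < staircase true (k.+1%:R * angle - z%:~R).
Proof.
elim: k => [|k IH].
  rewrite mul1r addrC 2!staircaseD ltrD2r ltr_pM2r ?invr_gt0//.
  have := staircase_false_true (- z%:~R).
  have -> : side_floor true (- z%:~R : R) = side_floor false (- z%:~R : R) + 1.
    by rewrite /side_floor -rmorphN /= intrKfloor intrKceil subrK.
  by rewrite rmorphD /=; lra.
have -> : k.+2%:R * angle - z%:~R = k.+1%:R * angle - z%:~R + angle.
  by rewrite -[k.+2%:R]natr1; ring.
rewrite 2!staircaseD; have := side_floor_false_true (k.+1%:R * angle - z%:~R).
by rewrite -(ler_int R); lra.
Qed.

(** Up to integers [j phi] is [- j alpha], so the letters of the word are the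
    increments of a fractional part, corrected by the mean slope [alpha]. *)
Lemma fibonacci_word_frac k : (fibonacci_word R k)%:~R =
  side_frac true (- (k.+2%:R * angle)) - side_frac true (- (k.+1%:R * angle)) + angle.
Proof.
rewrite /fibonacci_word /side_frac /side_floor.
have phiE : golden_ratio R = 2 - angle by rewrite /angle; ring.
have shift j : Num.floor (j%:R * golden_ratio R) = (2 * j)%N%:Z + Num.floor (- (j%:R * angle)).
  rewrite phiE mulrBr; have -> : j%:R * 2 = (2 * j)%N%:Z%:~R :> R.
    by rewrite -pmulrn natrM mulrC.
  by rewrite floorDzr ?intr_int// intrKfloor.
rewrite !shift (_ : (2 * k.+2)%N%:Z = 2 + (2 * k.+1)%N%:Z); last by lia.
rewrite !(rmorphD, rmorphN) /=; move: (Num.floor _) (Num.floor _) => f1 f2.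
by rewrite -[k.+2%:R]natr1; ring.
Qed.

(** Summation by parts: in the sum defining [delta] the increments of the
    fractional parts telescope against the geometric weights. *)
Lemma fibonacci_deltaE : delta = angle + staircase_defect true 0 / 2.
Proof.
pose u j : R := side_frac true (- (j.+1%:R * angle)).
have u1 j : `|u j| <= 1 by exact: side_frac_norm.
have -> : staircase_defect true 0 = dyadic_mean u.
  by congr dyadic_mean; apply/funext => j; rewrite sub0r.
rewrite /fibonacci_delta.
have w1 j : `|u j.+1 + (- u j + angle)| <= 3.
  have := u1 j; have := u1 j.+1; have := angle_gt0 R; have := angle_lt1 R.
  rewrite !ler_norml; lra.
have -> : limn (series (fun k => (fibonacci_word R k)%:~R / 2 ^+ k : R)) =
    2 * dyadic_mean (fun j => u j.+1 + (- u j + angle)).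
  rewrite /dyadic_mean -[RHS]/(2 *: limn _) -lim_seriesZ; last first.
    exact: (dyadic_mean_cvg w1).
  congr (limn (series _)); apply/funext => k /=.
  rewrite fibonacci_word_frac -addrA -[RHS]/(2 * (_ / _)) exprS.
  by rewrite /u; field; rewrite expf_neq0.
have a1 : `|angle| <= 1.
  by have := angle_gt0 R; have := angle_lt1 R; rewrite !ler_norml; lra.
have nu1 (j : nat) : `|- u j| <= 1 by rewrite normrN.
have v2 (j : nat) : `|- u j + angle| <= 2.
  by have := u1 j; have := a1; rewrite !ler_norml; lra.
have u2 (j : nat) : `|u j.+1| <= 2 by rewrite (le_trans (u1 _))// ler1n.
rewrite (dyadic_meanD u2 v2) (dyadic_meanD nu1 (fun=> a1)) (dyadic_meanN u1) dyadic_mean_cst.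
have := @dyadic_meanS _ u 1 u1.
suff -> : u 0%N = 1 - angle by lra.
rewrite /u /side_frac mul1r /=; suff -> : Num.floor (- angle) = -1 by rewrite rmorphN /=; ring.
by apply: floor_def; have := angle_gt0 R; have := angle_lt1 R; rewrite rmorphD rmorphN /=; lra.
Qed.

(** Both versions take the same value because [- j alpha] is never an integer for
    [j >= 1]. *)
Lemma staircase0 b : staircase b 0 = 0.
Proof.
rewrite /staircase fibonacci_deltaE.
suff -> : staircase_defect b 0 = staircase_defect true 0 by field.
congr dyadic_mean; apply/funext => j; rewrite /side_frac side_floor_nonint// => z.
by rewrite sub0r eqr_oppLR -rmorphN; exact: angle_irrational.
Qed.

Lemma staircase1 b : staircase b 1 = 1.
Proof. by have := staircaseDz b 0 1; rewrite add0r staircase0 add0r. Qed.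

(** The point [1 - alpha], whose image under the rotation is the origin of the
    circle, corresponds to the discontinuity of the contracted rotation. *)
Lemma staircase_discontinuity b : staircase b (1 - angle) = 2 * (1 - delta).
Proof.
have := staircaseB b 1; rewrite staircase1.
suff -> : side_floor b (1 - angle) = 0 by lra.
rewrite side_floor_nonint => [|z].
  by apply: floor_def; have := angle_gt0 R; have := angle_lt1 R; lra.
apply/eqP => /eqP; rewrite subr_eq addrC -subr_eq => /eqP h.
by have /eqP := angle_irrational R 0 (1 - z); apply; rewrite rmorphB /=; lra.
Qed.

(** Take [t] to be the supremum of the arguments at which the staircase has not
    yet passed [x]. *)
Lemma staircase_sandwich x : exists t, staircase false t <= x <= staircase true t.
Proof.
pose A := [set t | staircase true t <= x].
have A0 : A !=set0.
  exists (x - 2 * (delta - angle) - 1).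
  by rewrite /A /=; have := staircase_itv true (x - 2 * (delta - angle) - 1); lra.
have Aub : has_ubound A.
  exists (x + 1 - 2 * (delta - angle)) => t; rewrite /A /=.
  by have := staircase_itv true t; lra.
have Asup : has_sup A by [].
exists (sup A); apply/andP; split; rewrite leNgt; apply/negP => h.
  have [|d d0 hd] := @staircase_side_continuous false (sup A) ((staircase false (sup A) - x) / 2).
    by rewrite divr_gt0 ?subr_gt0.
  have [a Aa ha] := sup_adherent d0 Asup.
  have {}hd := hd a; have a_le : a <= sup A by exact: ub_le_sup.
  have := staircase_false_true a; move: Aa; rewrite /A /= => Aa Ba.
  have : side_nbhd false d (sup A) a by rewrite /side_nbhd ha.
  by move=> /hd; rewrite ler_norml; lra.
have [|d d0 hd] := @staircase_side_continuous true (sup A) ((x - staircase true (sup A)) / 2).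
  by rewrite divr_gt0 ?subr_gt0.
have /hd : side_nbhd true d (sup A) (sup A + d / 2) by apply/andP; lra.
rewrite ler_norml => hx.
have /(ub_le_sup Aub) : A (sup A + d / 2) by rewrite /A /=; lra.
by lra.
Qed.

End Staircase.

(** * The contracted rotation and its attractor *)

Section ContractedRotation.
Variable R : realType.
Implicit Types (b : bool) (x y s t : R).
Local Notation angle := (angle R).
Local Notation delta := (fibonacci_delta R).

Definition contracted_rotation x : R :=
  if x < 2 * (1 - delta) then x / 2 + delta else x / 2 + delta - 1.

Definition circle_rotation t : R :=
  if t < 1 - angle then t + angle else t + angle - 1.

(** The circle coordinates of each version, cut open at 0 so that the version is
    continuous at the end point that is kept. *)
Definition side_dom b t : bool := if b then 0 <= t < 1 else 0 < t <= 1.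

Definition attractor : set R :=
  [set x | exists b t, side_dom b t /\ x = staircase b t].

Lemma side_dom_itv b t : side_dom b t -> 0 <= t <= 1.
Proof. by rewrite /side_dom; case: b => /andP[h1 h2]; apply/andP; lra. Qed.

Lemma attractor_staircase b t : 0 <= t <= 1 -> attractor (staircase b t).
Proof.
move=> /andP[t0 t1]; case: b; last first.
  have [t0'|t0'] := ltP 0 t; first by exists false, t; rewrite /side_dom t0'.
  have -> : t = 0 by lra.
  by exists true, 0; rewrite !staircase0 /side_dom lexx ltr01.
have [t1'|t1'] := ltP t 1; first by exists true, t; rewrite /side_dom t0.
have -> : t = 1 by lra.
by exists false, 1; rewrite !staircase1 /side_dom lexx ltr01.
Qed.

Lemma attractor_itv x : attractor x -> 0 <= x <= 1.
Proof.
move=> [b [t [/side_dom_itv/andP[t0 t1] ->]]].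
by have := le_staircase b t0; have := le_staircase b t1; rewrite staircase0 staircase1; lra.
Qed.

(** Monotonicity locates [staircase b t] with respect to the discontinuity
    [2 (1 - delta) = staircase b (1 - alpha)]. Only at [t = 1 - alpha] may the
    version change: the point is mapped to 0, which belongs to the
    right-continuous version. *)
Lemma contracted_rotation_staircase b t : side_dom b t -> exists b',
  side_dom b' (circle_rotation t) /\
  contracted_rotation (staircase b t) = staircase b' (circle_rotation t).
Proof.
move=> bt; have a0 := angle_gt0 R; have a1 := angle_lt1 R.
have fl0 : side_floor b t = 0.
  move: bt; rewrite /side_dom /side_floor; case: b => /= h; first by apply: floor_def; lra.
  by apply/eqP; rewrite subr_eq0; apply/eqP/ceil_def; rewrite subrr; lra.
have := staircaseD b t; rewrite fl0 addr0.
rewrite /contracted_rotation /circle_rotation -(staircase_discontinuity R b).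
have [ta|ta] := ltP t (1 - angle).
  rewrite lt_staircase// => <-; exists b; split => //.
  by move: bt; rewrite /side_dom; case: b {fl0} => /= h; lra.
rewrite ltNge le_staircase//= => E.
have {}E : staircase b t / 2 + delta - 1 = staircase b (t + angle - 1).
  by rewrite -E (staircaseDz b _ (-1)).
rewrite E.
have [ta'|ta'] := ltP (1 - angle) t.
  exists b; split => //.
  by move: bt; rewrite /side_dom; case: b {fl0 E} => /= h; lra.
have -> : t + angle - 1 = 0 by lra.
by exists true; rewrite !staircase0 /side_dom lexx ltr01.
Qed.

Lemma contracted_rotation_orbit b t k : side_dom b t -> exists b',
  side_dom b' (iter k circle_rotation t) /\
  iter k contracted_rotation (staircase b t) = staircase b' (iter k circle_rotation t).
Proof.
move=> bt; elim: k => [|k [b' [b't IH]]]; first by exists b.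
rewrite !iterS IH.
by have [b'' h] := contracted_rotation_staircase b't; exists b''.
Qed.

Lemma attractor_invariant k x : attractor x -> attractor (iter k contracted_rotation x).
Proof.
move=> [b [t [bt ->]]].
have [b' h] := contracted_rotation_orbit k bt.
by exists b', (iter k circle_rotation t).
Qed.

Lemma circle_rotation_orbit t k :
  exists z : int, iter k circle_rotation t = t + k%:R * angle - z%:~R.
Proof.
elim: k => [|k [z zE]]; first by exists 0; rewrite mul0r addr0 subr0.
rewrite iterS zE /circle_rotation -natr1; case: ifP => _.
  by exists z; ring.
by exists (z + 1); rewrite rmorphD /=; ring.
Qed.

Lemma int_lt1_eq0 (z : int) : -1 < (z%:~R : R) < 1 -> z = 0.
Proof.
by rewrite -[1]/(1%:~R) -(rmorphN _ 1) !ltr_int => /andP[? ?]; lia.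
Qed.

(** A point of the closed unit interval that is congruent modulo 1 to a point of
    the open one is equal to it, so density modulo 1 suffices. *)
Lemma circle_rotation_dense b t u w N : side_dom b t -> 0 <= u -> u < w -> w <= 1 ->
  exists2 k, (N <= k)%N & u < iter k circle_rotation t < w.
Proof.
move=> bt u0 uw w1; have [k [z [Nk h]]] := angle_dense t N uw.
exists k => //; have [z' E] := circle_rotation_orbit t k.
have [b' [/side_dom_itv b't _]] := contracted_rotation_orbit k bt.
suff : z - z' = 0 by move/eqP; rewrite subr_eq0 => /eqP zz'; rewrite E -zz'.
by apply: int_lt1_eq0; rewrite rmorphB /=; lra.
Qed.

(** It suffices that the circle coordinate of the orbit enters a short interval on
    the side of [y] on which the staircase is continuous; both versions are then
    close to [y], so it does not matter which one the orbit follows. *)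
Lemma attractor_orbit_dense x y e N : attractor x -> attractor y -> 0 < e ->
  exists2 k, (N <= k)%N & `|iter k contracted_rotation x - y| <= e.
Proof.
move=> [bx [tx [btx ->]]] [b [t [bt ->]]] e0.
have [d d0 hd] := staircase_side_limit b t e0.
have [u [w [u0 uw w1 hs]]] : exists u w, [/\ 0 <= u, u < w, w <= 1 &
    forall s, u < s < w -> side_nbhd b d t s /\ s != t].
  move: bt {hd}; rewrite /side_dom /side_nbhd; case: b => /andP[t0 t1].
    exists t, (Num.min 1 (t + d)); split => [||| s] //.
    - by rewrite lt_min t1; lra.
    - by rewrite ge_min lexx.
    - by rewrite lt_min => /and3P[h1 h2 h3]; rewrite ltW//= h3 gt_eqF.
  exists (Num.max 0 (t - d)), t; split => [||| s] //.
  - by rewrite le_max lexx.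
  - by rewrite gt_max t0; lra.
  - by rewrite gt_max => /andP[/andP[h1 h2] h3]; rewrite h2 ltW//= lt_eqF.
have [k Nk /hs[h1 h2]] := circle_rotation_dense N btx u0 uw w1.
exists k => //; have [b' [_ ->]] := contracted_rotation_orbit k btx.
exact: hd.
Qed.

(** A point of the attractor is approached by the attractor from the side of its
    version. Keeping the circle distance below [1/4] is what separates the two
    orbits in [attractor_sensitive]. *)
Lemma attractor_side_neighbour x e : attractor x -> 0 < e -> exists b t (d : R),
  [/\ side_dom b t, x = staircase b t, 0 < d < 4^-1 &
  let s := if b then t + d else t - d in
  side_dom b s /\ `|staircase b s - x| <= e].
Proof.
move=> [b [t [bt ->]]] e0; have [d d0 hd] := staircase_side_limit b t e0.
pose d' := (Num.min (Num.min d 4^-1) (if b then 1 - t else t)) / 2.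
have d'0 : 0 < d'.
  rewrite divr_gt0// !lt_min d0 invr_gt0 ltr0n /=.
  by move: bt; rewrite /side_dom; case: (b) => /andP[? ?]; lra.
have d'd : d' < d.
  by rewrite ltr_pdivrMr//; apply: (@le_lt_trans _ _ d); [rewrite !ge_min lexx|lra].
have d'4 : d' < 4^-1.
  by rewrite ltr_pdivrMr//; apply: (@le_lt_trans _ _ 4^-1); [rewrite !ge_min lexx orbT|lra].
have d't : d' < if b then 1 - t else t.
  rewrite ltr_pdivrMr//; apply: (@le_lt_trans _ _ (if b then 1 - t else t)).
    by rewrite ge_min lexx orbT.
  by move: bt; rewrite /side_dom; case: (b) => /andP[? ?]; lra.
exists b, t, d'; split => //; first by rewrite d'0.
move: d' d'0 d'd {d'4} d't bt hd => d' d'0 d'd.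
rewrite /side_dom /side_nbhd; case: b => /= h /andP[t0 t1] hd.
  split; first lra.
  by apply: hd; [lra|rewrite gt_eqF//; lra].
split; first lra.
by apply: hd; [lra|rewrite lt_eqF//; lra].
Qed.

(** The amount by which orbits separate: the gap between the values at points of
    the circle that lie in the last and in the first quarter. *)
Definition separation : R := staircase false (3 / 4) - staircase true 4^-1.

Lemma separation_gt0 : 0 < separation.
Proof. by rewrite /separation subr_gt0 lt_staircase//; lra. Qed.

Lemma separated_staircase b b' s t : s <= 4^-1 -> 3 / 4 <= t ->
  separation <= staircase b' t - staircase b s.
Proof.
move=> s4 t4.
have : staircase b s <= staircase true 4^-1.
  apply: le_trans (le_staircase true s4).
  by case: b => //; exact: staircase_false_true.
have : staircase false (3 / 4) <= staircase b' t.
  apply: le_trans (le_staircase false t4) _.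
  by case: b' => //; exact: staircase_false_true.
by rewrite /separation; lra.
Qed.

(** The circle coordinates of [x] and [y] differ by [d] or by [d - 1] at all times,
    up to sign. When the coordinate of [x] is within [d] of the end of the unit
    interval towards which [y] lies, the second case must hold, and the two
    coordinates are in opposite outer quarters. *)
Lemma attractor_sensitive x e : attractor x -> 0 < e -> exists y k,
  [/\ attractor y, `|y - x| <= e &
   separation <= `|iter k contracted_rotation y - iter k contracted_rotation x|].
Proof.
move=> Kx /(attractor_side_neighbour Kx)[b [t [d [bt -> /andP[d0 d4]]]]] /=.
set s := if b then _ else _ => -[bs hs].
have [k hk] : exists k, if b then 1 - d < iter k circle_rotation t < 1
                        else 0 < iter k circle_rotation t < d.
  have d1 : 1 - d < 1 by lra.
  have d2 : 0 <= 1 - d by lra.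
  have d3 : d <= 1 by lra.
  case: (b).
    by have [k _ hk] := circle_rotation_dense 0 bt d2 d1 (lexx _); exists k.
  by have [k _ hk] := circle_rotation_dense 0 bt (lexx _) d0 d3; exists k.
exists (staircase b s), k; split => //; first by exists b, s.
have [b1 [b1t ->]] := contracted_rotation_orbit k bt.
have [b2 [b2s ->]] := contracted_rotation_orbit k bs.
have [z1 E1] := circle_rotation_orbit t k.
have [z2 E2] := circle_rotation_orbit s k.
have {b1t} := side_dom_itv b1t; have {b2s} := side_dom_itv b2s.
move: (iter k circle_rotation t) (iter k circle_rotation s) hk E1 E2.
move=> tk sk + E1 E2 sk1 tk1.
rewrite /s in E2; case: (b) E2 => E2 /andP[hk1 hk2].
  have /int_lt1_eq0 zE : -1 < ((z1 + 1 - z2)%:~R : R) < 1.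
    by rewrite rmorphB rmorphD /=; lra.
  have {}zE : (z2%:~R : R) = z1%:~R + 1.
    by move/eqP: zE; rewrite subr_eq0 => /eqP <-; rewrite rmorphD.
  rewrite distrC; apply: (le_trans _ (ler_norm _)); apply: separated_staircase; lra.
have /int_lt1_eq0 zE : -1 < ((z1 - 1 - z2)%:~R : R) < 1.
  by rewrite !rmorphB /=; lra.
have {}zE : (z2%:~R : R) = z1%:~R - 1.
  by move/eqP: zE; rewrite subr_eq0 => /eqP <-; rewrite rmorphB.
apply: (le_trans _ (ler_norm _)); apply: separated_staircase; lra.
Qed.

(** Points with the same circle coordinate are separated by a jump at that
    coordinate; otherwise some [k alpha] falls strictly between the coordinates,
    and the staircase jumps there. *)
Lemma attractor_gap x y : attractor x -> attractor y -> x < y ->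
  exists2 z, x < z < y & ~ attractor z.
Proof.
have gap t z : staircase false t < z < staircase true t -> ~ attractor z.
  move=> /andP[h1 h2] [b [s [_ zE]]]; have [st|st|st] := ltgtP s t.
  - by have := lt_staircase b false st; rewrite -zE; lra.
  - by have := lt_staircase true b st; rewrite -zE; lra.
  - by move: zE h1 h2; rewrite st => ->; case: b; rewrite ltxx.
move=> [b [s [_ ->]]] [b' [t [_ ->]]] xy.
have [st|ts|st] := ltgtP s t.
- have [k [z [k1 h]]] := angle_dense 0 1 st.
  case: k k1 h => // k _; rewrite add0r => /andP[h1 h2].
  have := staircase_jump R k z; move: h1 h2; move: (_ * _ - _) => u su ut ju.
  have h1 := lt_staircase b false su; have h2 := lt_staircase true b' ut.
  exists ((staircase false u + staircase true u) / 2); first lra.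
  by apply: (gap u); lra.
- by have := lt_staircase b' b ts; lra.
exists ((staircase b s + staircase b' t) / 2); first lra.
move: xy; rewrite st; case: b; case: b' => xy; try by rewrite ltxx in xy.
  by have := staircase_false_true t; lra.
by apply: (gap t); lra.
Qed.

(** A point of the interval that is not in the attractor lies strictly inside a
    jump of the staircase, which the attractor does not meet. *)
Lemma attractor_closed : closed attractor.
Proof.
move=> x clx.
have K01 : closure attractor `<=` [set x : R | 0 <= x <= 1].
  rewrite -(set_itvcc 0 1) [X in _ `<=` X](closure_id _).1; last first.
    exact: itv_closed.
  by apply: closure_subset => z /attractor_itv; rewrite set_itvcc.
have /andP[x0 x1] := K01 _ clx.
have [t /andP[h1 h2]] := staircase_sandwich x.
have t01 : 0 <= t <= 1.
  rewrite 2!leNgt; apply/andP; split; apply/negP => h.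
    by have := lt_staircase true true h; rewrite staircase0; lra.
  by have := lt_staircase false false h; rewrite staircase1; lra.
have [E|n1] := eqVneq x (staircase false t); first by rewrite E; exact: attractor_staircase.
have [E|n2] := eqVneq x (staircase true t); first by rewrite E; exact: attractor_staircase.
exfalso; have /clx [y [[b [s [_ ->]]]]] : nbhs x [set` `]staircase false t, staircase true t[].
  by apply: near_in_itvoo; rewrite in_itv /= !lt_def n1 h1 eq_sym n2 h2.
rewrite /= in_itv /=; have [st|ts|->] := ltgtP s t.
- by have := lt_staircase b false st; lra.
- by have := lt_staircase true b ts; lra.
- by case: (b); rewrite ltxx ?andbF.
Qed.

Lemma attractor_compact : compact attractor.
Proof.
apply: (subclosed_compact _ (@segment_compact R 0 1)); first exact: attractor_closed.
by move=> x /attractor_itv; rewrite set_itvcc.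
Qed.

Lemma attractor_limit_point x e : attractor x -> 0 < e ->
  exists y, [/\ y != x, attractor y & `|y - x| <= e].
Proof.
move=> Kx /(attractor_side_neighbour Kx)[b [t [d [bt xE /andP[d0 _]]]]] /=.
set s := if b then _ else _ => -[bs hs].
exists (staircase b s); split => //; last by exists b, s.
rewrite xE /s; case: (b).
  by rewrite gt_eqF// lt_staircase//; lra.
by rewrite lt_eqF// lt_staircase//; lra.
Qed.

Lemma attractor0 : attractor 0.
Proof. by rewrite -(staircase0 R true); apply: attractor_staircase; lra. Qed.

End ContractedRotation.

(** * From the eigenline to the network *)

Section Eigenline.
Variables (R : realType) (n : nat).
Implicit Types (v : 'cV[R]_n) (A : set R) (x s t : R).

Definition eigenline v A : set 'cV[R]_n := (fun t => t *: v) @` A.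

Lemma euclidean_norm_scale v t : euclidean_norm (t *: v) = `|t| * euclidean_norm v.
Proof.
rewrite /euclidean_norm -sqrtr_sqr -sqrtrM ?sqr_ge0//; congr Num.sqrt.
by rewrite mulr_sumr; apply: eq_bigr => i _; rewrite mxE exprMn.
Qed.

Lemma euclidean_norm_gt0 v i : 0 < v i 0 -> 0 < euclidean_norm v.
Proof.
move=> vi; rewrite sqrtr_gt0 (bigD1 i)//= ltr_wpDr ?exprn_gt0//.
by apply: sumr_ge0 => j _; exact: sqr_ge0.
Qed.

Lemma cvg_eigenline v (a : nat -> R) x :
  a k @[k --> \oo] --> x -> a k *: v @[k --> \oo] --> x *: v.
Proof. exact: cvgZr_tmp. Qed.

(** The ray is a copy of the line: [t |-> t v] is injective and continuous, and a
    coordinate of [v] recovers [t]. Connected subsets therefore project to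
    intervals in [A], which the gaps of [A] reduce to points. *)
Lemma cantor_set_eigenline v i A : v i 0 != 0 -> A !=set0 -> compact A ->
  (forall x e, A x -> 0 < e -> exists y, [/\ y != x, A y & `|y - x| <= e]) ->
  (forall x y, A x -> A y -> x < y -> exists2 z, x < z < y & ~ A z) ->
  cantor_set (eigenline v A).
Proof.
move=> vi A0 cA pA gA.
have vinj s t : s *: v = t *: v -> s = t.
  by move=> /matrixP/(_ i 0); rewrite !mxE => /(mulIf vi).
have cC : compact (eigenline v A).
  apply: continuous_compact => //; apply: continuous_subspaceT.
  exact: scalel_continuous.
have clC : closed (eigenline v A).
  by apply: compact_closed => //; exact: norm_hausdorff.
split => //.
- by have [x Ax] := A0; exists (x *: v), x.
- split => //; apply/seteqP; split => [p|p [x Ax <-] U].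
    move=> lp; apply: clC => U /lp[q [_ Cq Uq]]; by exists q.
  move=> /(scalel_continuous (x := v) (x0 := x)) [e /= e0 he].
  have [|y [yx Ay hy]] := pA x (e / 2) Ax; first by rewrite divr_gt0.
  exists (y *: v); split; first by apply: contra_neq yx; exact: vinj.
    by exists y.
  by apply: he; rewrite /= distrC (le_lt_trans hy)// ltr_pdivrMr//; lra.
- move=> p [x Ax <-]; apply/seteqP; split => [q [B [Bx BC cB] Bq]|_ ->]; last first.
    exists [set x *: v] => //; split => //; first by move=> _ ->; exists x.
    exact: connected1.
  have [y Ay yq] := BC _ Bq; rewrite -yq /=; congr (_ *: v).
  pose coord (p : 'cV[R]_n) : R := p i 0 / v i 0.
  have coordv s : coord (s *: v) = s by rewrite /coord mxE mulfK.
  have coord_cts : continuous (fun p : 'cV[R]_n => p i 0) by exact: coord_continuous.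
  have /connected_intervalP iB : connected (coord @` B).
    apply: connected_continuous_connected => //; apply: continuous_subspaceT => r.
    by apply: (cvgM (coord_cts r)); exact: cvg_cst.
  have BA z : (coord @` B) z -> A z.
    by move=> [_ /[dup] /BC [s As <-] _ <-]; rewrite coordv.
  have Bx' : (coord @` B) x by exists (x *: v).
  have By' : (coord @` B) y by exists q => //; rewrite -yq.
  have [yx|xy|//] := ltgtP y x.
    have [z /andP[h1 h2] nz] := gA _ _ Ay Ax yx.
    by case: nz; apply: BA; apply: (iB y x) => //; rewrite (ltW h1) (ltW h2).
  have [z /andP[h1 h2] nz] := gA _ _ Ax Ay xy.
  by case: nz; apply: BA; apply: (iB x y) => //; rewrite (ltW h1) (ltW h2).
Qed.

Lemma increasing_sequence (P : nat -> nat -> Prop) :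
  (forall i N, exists2 k, (N <= k)%N & P i k) ->
  exists m : nat -> nat, {homo m : i j / (i < j)%N} /\ forall i, P i (m i).
Proof.
move=> hP.
have /choice[f hf] iN : exists k, (iN.2 <= k)%N /\ P iN.1 k.
  by have [k] := hP iN.1 iN.2; exists k.
pose fix m i := if i is j.+1 then f (j.+1, (m j).+1) else f (0%N, 0%N).
exists m; split.
  by apply: homo_ltn => [|i]; first exact: ltn_trans; exact: (hf (i.+1, (m i).+1)).1.
case=> [|i]; first exact: (hf (0%N, 0%N)).2.
exact: (hf (i.+1, (m i).+1)).2.
Qed.

End Eigenline.

Section Network.
Variables (R : realType) (n : nat) (H : hopfield_network R n).
Variables (v : 'cV[R]_n) (g : R -> R) (A : set R).
Hypothesis v_gt0 : forall i, 0 < v i 0.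

Hypothesis orbitE : forall x k, A x -> network_orbit H (x *: v) k = iter k g x *: v.
Hypothesis A_iter : forall x k, A x -> A (iter k g x).

Lemma omega_limit_eigenline x : closed (eigenline v A) ->
  (forall x y e N, A x -> A y -> 0 < e ->
     exists2 k, (N <= k)%N & `|iter k g x - y| <= e) ->
  A x -> omega_limit H (x *: v) = eigenline v A.
Proof.
move=> clA dA Ax; apply/seteqP; split => [p [m [_ mp]]|_ [y Ay <-]].
  apply: (@closed_cvg _ _ _ _ _ (eigenline v A) clA _ p mp).
  by apply: nearW => k; rewrite orbitE//; exists (iter (m k) g x) => //; exact: A_iter.
have inv_gt0 i : 0 < i.+1%:R^-1 :> R by rewrite invr_gt0.
have [m [m_incr hm]] :=
  increasing_sequence (fun i N => dA x y i.+1%:R^-1 N Ax Ay (inv_gt0 i)).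
exists m; split => //; under eq_fun do rewrite orbitE//.
apply: cvg_eigenline; apply/cvgrPdist_le => e e0.
near=> k; rewrite distrC (le_trans (hm k))// ltW//.
by near: k; exact: (near_infty_natSinv_lt (PosNum e0)).
Unshelve. all: by end_near. Qed.

Lemma sensitive_eigenline x (i : 'I_n) (eta : R) : 0 < eta ->
  (forall y, A y -> state_space H (y *: v)) ->
  (forall e, 0 < e -> exists y k, [/\ A y, `|y - x| <= e &
     eta <= `|iter k g y - iter k g x|]) ->
  A x -> sensitive_dependence_at H (x *: v).
Proof.
move=> eta0 AX sA Ax; have nv := euclidean_norm_gt0 (v_gt0 i).
exists (eta * euclidean_norm v); first by rewrite mulr_gt0.
move=> e e0; have [|y [k [Ay yx h]]] := sA (e / euclidean_norm v).
  by rewrite divr_gt0.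
exists (y *: v), k; split; first exact: AX.
  by rewrite -scalerBl euclidean_norm_scale -ler_pdivlMr.
by rewrite !orbitE// -scalerBl euclidean_norm_scale ler_pM2r.
Qed.

End Network.

Theorem theorem2p3 (R : realType) (n : nat) (n_ge1 : (1 <= n)%N)
  (H : hopfield_network R n)
  (H1 : state_space H = [set x : 'cV[R]_n | forall i, 0 <= x i 0 <= 1] /\
        forall i, bias H i 0 = 0)
  (H2 : (forall i j, 0 < weight H i j) /\
        forall i, 3 / 4 < \sum_j weight H i j < 1)
  (rho : R) (v : 'cV[R]_n)
  (rho_v : perron_frobenius_data (weight H) rho v)
  (delta : R) (delta_def : delta = fibonacci_delta R)
  (H3 : forall i,
    [/\ act_dom H i = [set x : R | 0 <= x],
        forall x : R, 0 <= x -> 0 <= act H i x,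
        forall x : R, 0 <= x < 2 * (1 - delta) * rho * v i 0 ->
          act H i x = (2 * rho)^-1 * x + delta * v i 0,
        forall x : R, 2 * (1 - delta) * rho * v i 0 <= x <= rho * v i 0 ->
          act H i x = (2 * rho)^-1 * x + (delta - 1) * v i 0 &
        forall x : R, rho * v i 0 <= x ->
          act H i x = 2^-1 * v i 0 + (delta - 1) * v i 0]) :
  chaotic H.
Proof.
have [_ v_gt0 v1 Wv] := rho_v; have [W0 _] := H2; have [HX Hb] := H1.
pose i0 := Ordinal n_ge1.
have WvE i : \sum_j weight H i j * v j 0 = rho * v i 0.
  by have /matrixP/(_ i 0) := Wv; rewrite !mxE.
have rho0 : 0 < rho.
  rewrite -(pmulr_lgt0 _ (v_gt0 i0)) -WvE (bigD1 i0)//= ltr_wpDr ?mulr_gt0//.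
  by apply: sumr_ge0 => j _; rewrite mulr_ge0 ?ltW.
(* Both sides of each comparison in the activation functions carry the factor
   [rho * v i 0], so all coordinates switch branches at the same [t]. *)
have mapE t : 0 <= t <= 1 -> network_map H (t *: v) = contracted_rotation t *: v.
  move=> /andP[t0 t1]; apply/matrixP => i j; rewrite ord1 !mxE Hb subr0.
  have -> : \sum_j weight H i j * (t *: v) j 0 = t * (rho * v i 0).
    by rewrite -WvE mulr_sumr; apply: eq_bigr => k _; rewrite mxE mulrCA.
  have [_ _ lo hi _] := H3 i; have rv0 : 0 < rho * v i 0 by rewrite mulr_gt0.
  rewrite /contracted_rotation -delta_def; case: ltP => ht.
    rewrite lo; last by rewrite mulr_ge0 ?(ltW rv0)//= -mulrA ltr_pM2r.
    by field; rewrite gt_eqF.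
  rewrite hi; last by rewrite -mulrA ler_pM2r// ht ler_piMl// ltW.
  by field; rewrite gt_eqF.
have orbitE x k : attractor x ->
    network_orbit H (x *: v) k = iter k (@contracted_rotation R) x *: v.
  move=> Kx; elim: k => [//|k IH]; rewrite /network_orbit !iterS -/(network_orbit H _ k) IH.
  by rewrite mapE//; apply/attractor_itv/attractor_invariant.
have v_le1 i : v i 0 <= 1.
  by rewrite -v1 (bigD1 i)//= lerDl; apply: sumr_ge0 => j _; rewrite ltW.
have KX x : attractor x -> state_space H (x *: v).
  move=> /attractor_itv/andP[x0 x1]; rewrite HX => i; rewrite mxE.
  by rewrite mulr_ge0 ?mulr_ile1 ?(ltW (v_gt0 i)).
have Kcantor : cantor_set (eigenline v (@attractor R)).
  apply: (@cantor_set_eigenline _ _ _ i0); first by rewrite gt_eqF.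
  - by exists 0; exact: attractor0.
  - exact: attractor_compact.
  - exact: attractor_limit_point.
  - exact: attractor_gap.
have Kclosed : closed (eigenline v (@attractor R)) by case: Kcantor => _ _ [].
exists (eigenline v (@attractor R)); split => //.
- by move=> _ [x Kx <-]; exact: KX.
- move=> _ [x Kx <-]; apply: (omega_limit_eigenline orbitE _ Kclosed _ Kx).
  + by move=> y k Ky; exact: attractor_invariant.
  + exact: attractor_orbit_dense.
- move=> _ [x Kx <-]; apply: (sensitive_eigenline v_gt0 orbitE i0 (separation_gt0 R)) => //.
  by move=> e; exact: attractor_sensitive.
Qed.
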